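(* Let $k,t$ be integers with $\left\lceil\frac{t+2}{2}\right\rceil\leq k\leq t-1$ and $k\geq 5$, and let $H$ be the graph obtained from the complete graph $K_t$ by deleting the edges of a maximal matching $M$ of $K_t$. Then $$\operatorname{gr}_k(P_5:H)=\max\left\{\left\lceil\frac{1+\sqrt{1+8k}}{2}\right\rceil,\;t+1\right\}.$$
   Context: All graphs are finite, simple and undirected. $K_n$ is the complete graph on $n$ vertices and $P_5$ is the path with $5$ vertices and $4$ edges. A $k$-edge-coloring assigns to each edge one of $k$ colors; all $k$-edge-colorings are assumed exact, i.e. each of the $k$ colors is used at least once. An edge-colored graph is rainbow if all its edges have different colors and monochromatic if all its edges have a single color. A copy of a graph means a (not necessarily induced) subgraph isomorphic to it. For non-empty graphs $G,H$ (graphs with at least one edge) and a positive integer $k$, the Gallai-Ramsey number $\operatorname{gr}_k(G:H)$ is the minimum integer $N$ with $\binom{N}{2}\geq k$ (so that $K_N$ admits a $k$-edge-coloring) such that for all $n\geq N$, every $k$-edge-coloring of $K_n$ contains either a rainbow copy of $G$ or a monochromatic copy of $H$. *)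

(* Defs.v *)
From HB Require Import structures.
From mathcomp Require Import all_boot all_order all_algebra.
From mathcomp Require Import reals.

Set Implicit Arguments.
Unset Strict Implicit.
Unset Printing Implicit Defensive.

Record sgraph := SGraph {
  vertex :> finType;
  adj : rel vertex;
  adj_sym : symmetric adj;
  adj_irrefl : irreflexive adj
}.

Definition edges (G : sgraph) : {set {set G}} :=
  [set [set xy.1; xy.2] | xy : G * G & adj xy.1 xy.2].

Definition complete_adj (n : nat) : rel 'I_n := fun x y => x != y.
Fact complete_sym n : symmetric (@complete_adj n).
Proof. by move=> x y; rewrite /complete_adj eq_sym. Qed.
Fact complete_irrefl n : irreflexive (@complete_adj n).
Proof. by move=> x; rewrite /complete_adj eqxx. Qed.
Definition complete (n : nat) : sgraph :=
  SGraph (@complete_sym n) (@complete_irrefl n).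

(* path_graph n has n vertices (and n.-1 edges). *)
Definition path_adj (n : nat) : rel 'I_n :=
  fun x y => (x.+1 == y :> nat) || (y.+1 == x :> nat).
Fact path_sym n : symmetric (@path_adj n).
Proof. by move=> x y; rewrite /path_adj orbC. Qed.
Fact path_irrefl n : irreflexive (@path_adj n).
Proof. by move=> x; rewrite /path_adj orbb gtn_eqF. Qed.
Definition path_graph (n : nat) : sgraph :=
  SGraph (@path_sym n) (@path_irrefl n).

Definition delete_adj (G : sgraph) (M : {set {set G}}) : rel G :=
  fun x y => adj x y && ([set x; y] \notin M).
Fact delete_sym (G : sgraph) (M : {set {set G}}) : symmetric (delete_adj M).
Proof. by move=> x y; rewrite /delete_adj adj_sym setUC. Qed.
Fact delete_irrefl (G : sgraph) (M : {set {set G}}) :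
  irreflexive (delete_adj M).
Proof. by move=> x; rewrite /delete_adj adj_irrefl. Qed.
Definition delete_edges (G : sgraph) (M : {set {set G}}) : sgraph :=
  SGraph (delete_sym M) (delete_irrefl M).

Definition matching (G : sgraph) (M : {set {set G}}) : bool :=
  (M \subset edges G) && trivIset M.

Definition maximal_matching (G : sgraph) (M : {set {set G}}) : bool :=
  maxset (@matching G) M.

Definition image_edges (G F : sgraph) (f : G -> F) : {set {set F}} :=
  [set f @: (e : {set G}) | e in edges G].

(* A not necessarily induced subgraph of F isomorphic to G is presented by an
   isomorphism f from G onto it. *)
Definition is_copy (G F : sgraph) (f : G -> F) : Prop :=
  injective f /\ image_edges f \subset edges F.

(* A k-edge-coloring of F is given by c : {set F} -> 'I_k; only the values of c
   on edges F are ever used. *)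
Definition exact_coloring (F : sgraph) (k : nat) (c : {set F} -> 'I_k) : Prop :=
  forall i : 'I_k, exists2 e, e \in edges F & c e = i.

Definition rainbow (F : sgraph) (k : nat) (c : {set F} -> 'I_k)
    (A : {set {set F}}) : Prop :=
  {in A &, injective c}.

Definition monochromatic (F : sgraph) (k : nat) (c : {set F} -> 'I_k)
    (A : {set {set F}}) : Prop :=
  exists i : 'I_k, {in A, forall e, c e = i}.

Definition gr_bound (k : nat) (G H : sgraph) (N : nat) : Prop :=
  k <= 'C(N, 2) /\
  forall n : nat, N <= n ->
  forall c : {set complete n} -> 'I_k, exact_coloring c ->
    (exists2 f : G -> complete n, is_copy f & rainbow c (image_edges f)) \/
    (exists2 f : H -> complete n, is_copy f & monochromatic c (image_edges f)).

(* gr_k(G : H) = N, i.e. N is the least gr_bound; stated as a relation because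
   the existence of such a bound is not part of the definition. *)
Definition is_gallai_ramsey (k : nat) (G H : sgraph) (N : nat) : Prop :=
  gr_bound k G H N /\ forall N' : nat, gr_bound k G H N' -> N <= N'.

(* Main.v *)
(* In the stated range the maximum is [t + 1].
   Upper bound: take an exact colouring of [K_n], [n > t], with at least five
   colours and no rainbow [P_5].  Short case analyses on paths show that a
   vertex [v] seeing three colours misses at most one colour, and then that
   [K_n - v] is monochromatic, so that it contains [H].  Otherwise every vertex
   sees at most two colours; any two vertices share the colour of the edge
   between them, so one colour is seen by every vertex and the other colour
   classes live on disjoint vertex sets.  Two adjacent vertices from each of
   these [k - 1 >= t / 2] sets carry a copy of [H] in the dominant colour.
   Lower bound: colour [K_t] so that [k - 1] edges at one vertex have private
   colours and all other edges a common one. *)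
Require Import Defs.
From mathcomp Require Import all_boot all_order all_algebra.
From mathcomp Require Import reals boolp lra.

(** * Colourings without a rainbow [P_5] *)

Section NoRainbowP5.
Variables (V C : finType) (col : V -> V -> C).
Hypothesis colC : forall x y, col x y = col y x.
Hypothesis no_rainbow_P5 : forall a b c d e,
  a <> b -> a <> c -> a <> d -> a <> e -> b <> c -> b <> d -> b <> e ->
  c <> d -> c <> e -> d <> e ->
  col a b <> col b c -> col a b <> col c d -> col a b <> col d e ->
  col b c <> col c d -> col b c <> col d e -> col c d <> col d e -> False.

Definition mono_off (v : V) := exists i, forall x y,
  x <> y -> x <> v -> y <> v -> col x y = i.

Definition seen (v : V) : {set C} := [set col v u | u in [set~ v]].

Lemma seenP v i : reflect (exists2 u, u <> v & i = col v u) (i \in seen v).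
Proof.
apply: (iffP imsetP) => -[u uv ->]; exists u => //; move: uv; rewrite !inE.
  by move/eqP.
by move/eqP.
Qed.

(** [congruence] reverses edges by [colC] and gets missing vertex inequalities from colours: equal
    vertices would give equal colours. *)
Ltac path a b c d e := apply: (no_rainbow_P5 a b c d e); congruence.

Definition star4 v a1 a2 a3 a4 :=
  [/\ v <> a1, v <> a2, v <> a3 & v <> a4] /\
  [/\ col v a1 <> col v a2, col v a1 <> col v a3, col v a1 <> col v a4 &
   [/\ col v a2 <> col v a3, col v a2 <> col v a4 & col v a3 <> col v a4]].

Definition new_color v a1 a2 a3 a4 i :=
  [/\ i <> col v a1, i <> col v a2, i <> col v a3 & i <> col v a4].

(** A path can run from the edge [a1 a2] through [v] to [a3 a4], entering and leaving by either end.
    Whatever other colour [a3 a4] had, one of these paths would be rainbow. *)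
Lemma opposite_edge v a1 a2 a3 a4 : star4 v a1 a2 a3 a4 ->
  new_color v a1 a2 a3 a4 (col a1 a2) -> col a3 a4 = col a1 a2.
Proof.
move=> [[? ? ? ?] [? ? ? [? ? ?]]] [? ? ? ?].
apply/eqP/negP => /negP/eqP ne.
have [e|n3] := col a3 a4 =P col v a3; first by path a2 a1 v a4 a3.
have [e|n1] := col a3 a4 =P col v a1; last by path a2 a1 v a3 a4.
by path a1 a2 v a3 a4.
Qed.

Lemma adjacent_edge v a1 a2 a3 a4 : star4 v a1 a2 a3 a4 ->
  new_color v a1 a2 a3 a4 (col a1 a2) -> col a2 a3 = col a1 a2.
Proof.
move=> st nc; have e34 := opposite_edge _ _ _ _ _ st nc.
move: st nc => [[? ? ? ?] [? ? ? [? ? ?]]] [? ? ? ?].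
apply/eqP/negP => /negP/eqP ne.
have [e|n4] := col a2 a3 =P col v a4; first by path a1 v a2 a3 a4.
have [e|n1] := col a2 a3 =P col v a1; first by path a4 v a3 a2 a1.
by path a4 v a1 a2 a3.
Qed.

(** The new colour spreads: first to all edges among the leaves, then to the edges from a leaf to a
    further vertex, finally to the edges between two further vertices. *)
Lemma star4_mono_off v a1 a2 a3 a4 : star4 v a1 a2 a3 a4 ->
  new_color v a1 a2 a3 a4 (col a1 a2) -> mono_off v.
Proof.
move=> st nc.
have e34 := opposite_edge _ _ _ _ _ st nc.
have e23 := adjacent_edge _ _ _ _ _ st nc.
move: st nc => [[? ? ? ?] [? ? ? [? ? ?]]] [? ? ? ?].
(* Exchanging leaves preserves the star, so [adjacent_edge] reaches the remaining pairs. *)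
have e24 : col a2 a4 = col a1 a2.
  by apply: (adjacent_edge v a1 a2 a4 a3); repeat split; congruence.
have e13 : col a1 a3 = col a2 a1.
  by apply: (adjacent_edge v a2 a1 a3 a4); repeat split; congruence.
have e14 : col a1 a4 = col a2 a1.
  by apply: (adjacent_edge v a2 a1 a4 a3); repeat split; congruence.
(* Stated for any order of the leaves, so that each of them can take the place of [b1]. *)
have ew w b1 b2 b3 b4 : star4 v b1 b2 b3 b4 ->
    new_color v b1 b2 b3 b4 (col a1 a2) ->
    w <> v -> w <> b1 -> w <> b2 -> w <> b3 -> w <> b4 ->
    col b1 b2 = col a1 a2 -> col b1 b3 = col a1 a2 -> col b1 b4 = col a1 a2 ->
    col w b1 = col a1 a2.
  move=> [[? ? ? ?] [? ? ? [? ? ?]]] [? ? ? ?] *.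
  apply/eqP/negP => /negP/eqP ne.
  have [e|n2] := col w b1 =P col v b2; first by path w b1 b3 v b4.
  have [e|n3] := col w b1 =P col v b3; first by path w b1 b2 v b4.
  by path w b1 b2 v b3.
have {}ew w i : i \in [:: a1; a2; a3; a4] -> w <> i -> w <> v ->
    col w i = col a1 a2.
  have [->|?] := w =P a1; first by rewrite !inE => /or4P[]/eqP ->; congruence.
  have [->|?] := w =P a2; first by rewrite !inE => /or4P[]/eqP ->; congruence.
  have [->|?] := w =P a3; first by rewrite !inE => /or4P[]/eqP ->; congruence.
  have [->|?] := w =P a4; first by rewrite !inE => /or4P[]/eqP ->; congruence.
  rewrite !inE => /or4P[]/eqP -> _ wv.
  - by apply: (ew w a1 a2 a3 a4); repeat split; congruence.
  - by apply: (ew w a2 a1 a3 a4); repeat split; congruence.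
  - by apply: (ew w a3 a1 a2 a4); repeat split; congruence.
  - by apply: (ew w a4 a1 a2 a3); repeat split; congruence.
exists (col a1 a2) => x y xy xv yv.
have [xa|xa] := boolP (x \in [:: a1; a2; a3; a4]).
  by rewrite colC; apply: ew => //; congruence.
have [ya|ya] := boolP (y \in [:: a1; a2; a3; a4]); first by apply: ew.
have y1 : col y a1 = col a1 a2.
  by apply: ew; rewrite ?inE ?eqxx //; move=> e; rewrite e inE eqxx in ya.
move: xa ya; rewrite !inE !negb_or.
move=> /and4P[/eqP ? /eqP ? /eqP ? /eqP ?] /and4P[/eqP ? /eqP ? /eqP ? /eqP ?].
apply/eqP/negP => /negP/eqP ne.
have y2 : col y a2 = col a1 a2 by apply: ew; rewrite ?inE ?eqxx ?orbT.
have [e|n1] := col x y =P col v a1; first by path x y a2 v a3.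
have [e|n2] := col x y =P col v a2; first by path x y a1 v a3.
by path x y a1 v a2.
Qed.

(* Joining [x], [y] to [v] and to two further neighbours of [v] produces a
   four-coloured star with a fifth colour among its leaves. *)
Lemma cross_mono_off v x y : x <> y -> x <> v -> y <> v ->
  col v x <> col v y -> col x y <> col v x -> col x y <> col v y ->
  4 <= #|seen v :\ col x y| -> mono_off v.
Proof.
move=> xy xv yv nxy nx ny.
rewrite (cardsD1 (col v x)) (cardsD1 (col v y) (_ :\ _ :\ _)) => c4.
have : 1 < #|seen v :\ col x y :\ col v x :\ col v y|.
  move: c4; do 2!case: (_ \in _); rewrite ?add1n ?add0n ?ltnS //;
  exact: leq_trans.
case/card_gt1P => i [j [+ + ij]]; rewrite !inE.
move=> /and4P[/eqP iy /eqP ix /eqP ie /seenP[a3 a3v e3]].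
move=> /and4P[/eqP jy /eqP jx /eqP je /seenP[a4 a4v e4]].
move/eqP: ij => ij.
apply: (star4_mono_off v x y a3 a4); repeat split; congruence.
Qed.

(** Edges of two unseen colours [p] and [q] avoid [v]. If they share an end, [v] sees only two
    colours. If they are disjoint, their four ends have one colour from [v], and vertices of two
    other colours complete a rainbow path. *)
Lemma unseen_eq v z1 z2 z3 p q : 4 < #|V| ->
  z1 <> v -> z2 <> v -> z3 <> v ->
  col v z1 <> col v z2 -> col v z1 <> col v z3 -> col v z2 <> col v z3 ->
  (exists x y, x <> y /\ col x y = p) -> (exists x y, x <> y /\ col x y = q) ->
  p \notin seen v -> q \notin seen v -> p = q.
Proof.
move=> n5 z1v z2v z3v n12 n13 n23 [x [y [xy ep]]] [x' [y' [xy' eq]]] hp hq.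
have {}hp u : u <> v -> col v u <> p.
  by move=> uv e; case/seenP: hp; exists u.
have {}hq u : u <> v -> col v u <> q.
  by move=> uv e; case/seenP: hq; exists u.
have xv : x <> v by move=> e; apply: (hp y); congruence.
have yv : y <> v by move=> e; apply: (hp x); congruence.
have xv' : x' <> v by move=> e; apply: (hq y'); congruence.
have yv' : y' <> v by move=> e; apply: (hq x'); congruence.
apply/eqP/negP => /negP/eqP pq.
have share a b b' : a <> v -> b <> v -> b' <> v -> a <> b -> a <> b' ->
    col a b = p -> col a b' = q -> False.
  move=> av bv bv' ab ab' eb eb'.
  have bb' : b <> b' by congruence.
  have out u : u <> v -> u <> a -> u <> b -> u <> b' ->
      col v u = col v b' /\ col v u = col v b.
    move=> uv ua ub ub'; move: (hp _ uv) (hq _ uv) (hp _ bv) (hq _ bv) (hp _ bv') (hq _ bv') => *.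
    split; apply/eqP/negP => /negP/eqP ne.
      by path b a b' v u.
    by path b' a b v u.
  (* A fifth vertex [w] forces [b] and [b'] to have the same colour from [v], so that [v] sees only
     the colours of [a] and [b]. *)
  have [w] : exists w, w \notin [:: v; a; b; b'].
    apply/existsP; rewrite -negb_forall; apply/negP => /forallP h.
    suff: #|V| <= size [:: v; a; b; b'] by rewrite leqNgt n5.
    by apply: leq_trans (card_size _); apply/subset_leq_card/subsetP => u _.
  rewrite !inE !negb_or => /and4P[/eqP wv /eqP wa /eqP wb /eqP wb'].
  have [e1 e2] := out w wv wa wb wb'.
  have two u : u <> v -> col v u = col v a \/ col v u = col v b.
    move=> uv; have [->|ua] := u =P a; first by left.
    right; have [->//|ub] := u =P b; have [->|ub'] := u =P b'; first congruence.
    by case: (out u uv ua ub ub').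
  by case: (two _ z1v) (two _ z2v) (two _ z3v) => [?|?] [?|?] [?|?]; congruence.
have [e|xx'] := x =P x'; first by apply: (share x y y'); congruence.
have [e|xy''] := x =P y'; first by apply: (share x y x'); congruence.
have [e|yx'] := y =P x'; first by apply: (share y x y'); congruence.
have [e|yy'] := y =P y'; first by apply: (share y x x'); congruence.
have same a b a' b' : a <> v -> b <> v -> a' <> v -> b' <> v ->
   a <> b -> a' <> b' -> a <> a' -> a <> b' -> b <> a' -> b <> b' ->
   col a b = p -> col a' b' = q -> col v b = col v b'.
  move=> av bv av' bv' *.
  move: (hp _ bv) (hq _ bv) (hp _ bv') (hq _ bv') => *.
  by apply/eqP/negP => /negP/eqP ne; path a b v b' a'.
have e1 : col v y = col v y' by apply: (same x y x' y'); congruence.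
have e2 : col v y = col v x' by apply: (same x y y' x'); congruence.
have e3 : col v x = col v y' by apply: (same y x x' y'); congruence.
(* Two of the three seen colours differ from that of [y]. Both [z z'] and [y y'] then get the colour
   of [v y], and no colour is left for [y z]. *)
have [z [z' [zv zv' zz' [zy zy']]]] : exists z z', [/\ z <> v, z' <> v,
    col v z <> col v z' & col v z <> col v y /\ col v z' <> col v y].
  have [e|?] := col v z1 =P col v y; first by exists z2, z3; repeat split; congruence.
  have [e|?] := col v z2 =P col v y; first by exists z1, z3; repeat split; congruence.
  by exists z1, z2; repeat split; congruence.
move: (hp _ zv) (hq _ zv) (hp _ zv') (hq _ zv') (hp _ yv) (hq _ yv) => *.
have ezz' : col z z' = col v y.
  apply/eqP/negP => /negP/eqP ne.
  have [e|?] := col z z' =P p; first by path x' y' v z z'.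
  have [e'|?] := col z z' =P col v z; first by path x y v z' z.
  by path x y v z z'.
have eyy' : col y y' = col v y.
  apply/eqP/negP => /negP/eqP ne.
  have [e|?] := col y y' =P p.
    by path x' y' y v z.
  have [e'|?] := col y y' =P col v z.
    by path x y y' v z'.
  by path x y y' v z.
have [e|?] := col y z =P p; first by path x' y' y z v.
have [e|?] := col y z =P col v z'; first by path x' y' y z v.
have [e|?] := col y z =P col v y; first by path x y z v z'.
by path v z' z y x.
Qed.

(* An edge whose colour is that of one of its ends (as seen from [v]) is
   directed towards that end; every tournament on three vertices has a
   directed path through all of them. *)
Lemma directed_path v (Q : V -> Prop) a b d : Q a -> Q b -> Q d ->
  col v a <> col v b -> col v b <> col v d -> col v d <> col v a ->
  (forall x y, Q x -> Q y -> col v x <> col v y ->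
     col x y = col v x \/ col x y = col v y) ->
  exists x y z, [/\ Q x, Q y & Q z] /\
    [/\ col v x <> col v y, col v y <> col v z & col v z <> col v x] /\
    col x y = col v y /\ col y z = col v z.
Proof.
move=> qa qb qd ab bd da tour.
have [e1|e1] := tour a b qa qb ab; have [e2|e2] := tour b d qb qd bd;
have [e3|e3] := tour d a qd qa da.
- by exists d, b, a; repeat split; congruence.
- by exists d, b, a; repeat split; congruence.
- by exists b, a, d; repeat split; congruence.
- by exists b, d, a; repeat split; congruence.
- by exists a, d, b; repeat split; congruence.
- by exists d, a, b; repeat split; congruence.
- by exists a, b, d; repeat split; congruence.
- by exists a, b, d; repeat split; congruence.
Qed.

(** By [unseen_eq] at most one colour is unseen from [v], so at least four are seen. If [mono_off v]
    failed, [cross_mono_off] would restrict the edges between differently coloured neighbours enough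
    for a directed path that extends to a rainbow [P_5]. *)
Lemma many_seen_mono_off v : 4 < #|V| -> 4 < #|C| ->
  (forall i, exists x y, x <> y /\ col x y = i) ->
  2 < #|seen v| -> mono_off v.
Proof.
move=> n5 k5 onto seen3.
have unseen1 : #|~: seen v| <= 1.
  rewrite leqNgt; apply/negP => /card_gt1P[p [q [+ + pq]]].
  rewrite !inE => hp hq; case/eqP: pq.
  case/card_gt2P: seen3 => i [j [l [[/seenP[z1 z1v e1] /seenP[z2 z2v e2]
    /seenP[z3 z3v e3]] [/eqP ij /eqP jl /eqP li]]]].
  by apply: (unseen_eq v z1 z2 z3) => //; congruence.
have seen4 : 4 <= #|seen v|.
  rewrite -(leq_add2r 1); apply: leq_trans (leq_add (leqnn _) unseen1).
  by rewrite cardsC.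
have [//|nomono] := pselect (mono_off v); exfalso.
(* When all colours are seen, the directed path [x y z] is extended by [v] and a neighbour [w] of a
   fourth colour. *)
have [h|/card_gt0P[p]] := posnP #|~: seen v|.
  have seen5 : 5 <= #|seen v|.
    by move: k5; rewrite -(cardsC (seen v)) h addn0.
  case/card_gt2P: seen3 => i [j [l [[/seenP[a av ei] /seenP[b bv ej]
    /seenP[d dv el]] [/eqP ij /eqP jl /eqP li]]]].
  have [|||x y xv yv nxy|x [y [z [[xv yv zv] [[xy yz zx] [exy eyz]]]]]] :=
    directed_path v (fun x => x <> v) a b d av bv dv; try congruence.
    have [?|?] := col x y =P col v x; first by left.
    have [?|?] := col x y =P col v y; first by right.
    case: nomono; apply: (cross_mono_off v x y) => //; first congruence.
    move: seen5; rewrite (cardsD1 (col x y)).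
    by case: (_ \in _) => // /ltnW.
  have : 0 < #|seen v :\ col v x :\ col v y :\ col v z|.
    move: seen5; rewrite (cardsD1 (col v x)) (cardsD1 (col v y) (_ :\ _)).
    rewrite (cardsD1 (col v z) (_ :\ _ :\ _)).
    by do 3!case: (_ \in _); rewrite ?add1n ?add0n ?ltnS //; exact: leq_trans.
  case/card_gt0P => m; rewrite !inE.
  move=> /and4P[/eqP mz /eqP my /eqP mx /seenP[w wv ew]].
  by path w v x y z.
(* Here [p] is unseen and lies on an edge [x y]. An edge between different colours of [v] cannot
   have colour [p], so [x] and [y] have the same colour from [v]. A directed path among the vertices
   of other colours is extended by [y] and [x]. *)
rewrite inE => hp; have [x [y [xy ep]]] := onto p.
have {}seen4 : 4 <= #|seen v :\ p|.
  by move: seen4; rewrite (cardsD1 p) (negPf hp) add0n.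
have {}hp u : u <> v -> col v u <> p.
  by move=> uv e; case/seenP: hp; exists u.
have xv : x <> v by move=> e; apply: (hp y); congruence.
have yv : y <> v by move=> e; apply: (hp x); congruence.
have cross a b : a <> v -> b <> v -> col v a <> col v b -> col a b <> p.
  move=> av bv nab eab; move: (hp a av) (hp b bv) => ha hb; case: nomono.
  by apply: (cross_mono_off v a b); rewrite ?eab //; congruence.
have [exy|nxy] := col v x =P col v y; last by case: (cross x y).
have pick2 m : 1 < #|seen v :\ p :\ col v y :\ m|.
  move: seen4; rewrite (cardsD1 (col v y)) (cardsD1 m (_ :\ _ :\ _)).
  by do 2!case: (_ \in _); rewrite ?add1n ?add0n ?ltnS //; exact: leq_trans.
pose Q b := b <> v /\ col v b <> col v y.
(* The path [x y b v] ends in [b'] or [b''], whichever has a colour from [v] different from that of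
   [y b]. *)
have yb b : Q b -> col y b = col v b.
  move=> [bv nb]; apply/eqP/negP => /negP/eqP ne.
  have /card_gt1P[i [j [+ + /eqP ij]]] := pick2 (col v b).
  rewrite !inE => /and4P[/eqP ib /eqP iy /eqP ip /seenP[b' b'v ei]].
  move=> /and4P[/eqP jb /eqP jy /eqP jp /seenP[b'' b''v ej]].
  move: (hp b bv) (cross y b yv bv (nesym nb)) => *.
  have [e|?] := col y b =P col v b'; first by path x y b v b''.
  by path x y b v b'.
have bb b b' : Q b -> Q b' -> col v b <> col v b' ->
    col b b' = col v b \/ col b b' = col v b'.
  move=> qb qb' nbb; have eb := yb _ qb; have eb' := yb _ qb'.
  move: qb qb' => [bv nb] [b'v nb'].
  move: (cross b b' bv b'v nbb) (hp b bv) (hp b' b'v) => *.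
  have [e|ne] := col b b' =P col v b; first by left.
  right; apply/eqP/negP => /negP/eqP ne'.
  by path x y b b' v.
have : 2 < #|seen v :\ p :\ col v y|.
  by move: seen4; rewrite (cardsD1 (col v y)); case: (_ \in _) => // /ltnW.
case/card_gt2P => i [j [l [[+ + +] [/eqP ij /eqP jl /eqP li]]]]; rewrite !inE.
move=> /and3P[/eqP iy /eqP ip /seenP[b2 b2v e2]].
move=> /and3P[/eqP jy /eqP jp /seenP[b3 b3v e3]].
move=> /and3P[/eqP ly /eqP lp /seenP[b4 b4v e4]].
have [||||||a [b [d [[qa qb qd] [[ab bd da] [eab ebd]]]]]] :=
  directed_path v Q b2 b3 b4 _ _ _ _ _ _ bb; try (split; congruence);
  try congruence.
have ya := yb a qa; move: qa qb qd => [av na] [bv nb] [dv nd].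
move: (hp a av) (hp b bv) (hp d dv) => *.
by path x y a b d.
Qed.

(* Two-element sets that pairwise intersect form a star or a triangle, and
   four colours rule out the triangle. *)
Lemma few_seen_dominant : 1 < #|V| -> 3 < #|C| ->
  (forall i, exists x y, x <> y /\ col x y = i) ->
  (forall v, #|seen v| <= 2) ->
  exists i0, forall v x y, x <> v -> y <> v ->
    col v x <> i0 -> col v y <> i0 -> col v x = col v y.
Proof.
move=> n2 k4 onto seen2.
have three u i j l : i \in seen u -> j \in seen u -> l \in seen u ->
    i <> j -> i <> l -> j <> l -> False.
  move=> iu ju lu ij il jl; have := seen2 u; rewrite leqNgt => /negP; apply.
  by apply/card_gt2P; exists i, j, l; split; split=> //; apply/eqP; congruence.
have mem u w : w <> u -> col u w \in seen u by move=> wu; apply/seenP; exists w.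
have meet u w : exists2 i, i \in seen u & i \in seen w.
  have [<-|uw] := u =P w; last first.
    by exists (col u w); [|rewrite colC]; apply: mem; congruence.
  have [x [y [_ _ /eqP xy]]] := card_gt1P n2.
  have [xu|xu] := x =P u; last by exists (col u x); apply: mem.
  by exists (col u y); apply: mem; congruence.
have [/existsP[v]|/existsPn small] := boolP [exists v, 1 < #|seen v|]; last first.
  (* If every vertex sees at most one colour, any [i] will do. *)
  have [i _] := card_gt0P (ltnW (ltnW (ltnW k4))).
  exists i => v x y xv yv _ _; have := small v; rewrite -leqNgt => /card_le1_eqP.
  by apply; apply: mem.
case/card_gt1P => p [q [pv qv /eqP pq]].
have : 1 < #|~: [set p; q]|.
  by move: k4; rewrite -(cardsC [set p; q]) cards2 -(ltn_add2l 2); case: (_ != _) => // /ltnW.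
case/card_gt1P => r [s [+ + /eqP rs]].
rewrite !inE !negb_or => /andP[/eqP rp /eqP rq] /andP[/eqP sp /eqP sq].
have seen_by i : exists v, i \in seen v.
  by have [x [y [xy <-]]] := onto i; exists x; apply: mem; congruence.
have [w rw] := seen_by r; have [w' sw'] := seen_by s.
(* Since [v] sees [p'], [q'] and [w] sees [p'], [r], a vertex without [p'] must see [q'] and [r].
   This gives [p'] to [w'], which sees [s]; then a vertex without [p'] would see [q'], [r] and [s].
   The common colour may be [p] or [q], hence the generality. *)
have core p' q' : p' \in seen v -> q' \in seen v -> p' <> q' -> r <> p' ->
    r <> q' -> s <> p' -> s <> q' -> p' \in seen w -> forall u, p' \in seen u.
  move=> {p q pv qv pq rp rq sp sq} pv qv pq rp rq sp sq pw.
  have only u i j l : i \in seen u -> j \in seen u -> l \in seen u ->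
      i <> j -> l = i \/ l = j.
    move=> iu ju lu ij; have [|li] := l =P i; first by left.
    by have [|lj] := l =P j; [right|case: (three u i j l) => //; congruence].
  have pw' : p' \in seen w'.
    have [i iw' iv] := meet w' v; have [j jw' jw] := meet w' w.
    have [e|e] := only v p' q' i pv qv iv pq; subst i => //.
    have [|e|e] := only w p' r j pw rw jw; first congruence; subst j => //.
    by case: (three w' s q' r) => //; congruence.
  move=> u; have [i iu iv] := meet u v; have [j ju jw] := meet u w.
  have [l lu lw'] := meet u w'.
  have [e|e] := only v p' q' i pv qv iv pq; subst i => //.
  have [|e|e] := only w p' r j pw rw jw; first congruence; subst j => //.
  have [|e|e] := only w' p' s l pw' sw' lw'; first congruence; subst l => //.
  by case: (three u q' r s) => //; congruence.
have [i0 i0P] : exists i0, forall u, i0 \in seen u.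
  have [i iw iv] := meet w v.
  have [e|ip] := i =P p; first by subst i; exists p; apply: (core p q).
  have [e|iq] := i =P q.
    by subst i; exists q; apply: (core q p) => //; congruence.
  by case: (three v p q i) => //; congruence.
exists i0 => u x y xu yu nx ny; apply/eqP/negP => /negP/eqP nxy.
by apply: (three u i0 (col u x) (col u y)) => //; try apply: mem; congruence.
Qed.
End NoRainbowP5.

(** * Embedding [H] into the dominant colour *)

Lemma injection_in {A B : finType} (S : {set A}) (T : {set B}) :
  #|S| <= #|T| -> 0 < #|T| ->
  exists2 h : A -> B, {in S &, injective h} & forall a, h a \in T.
Proof.
move=> ST /card_gt0P[b0 b0T].
(* Elements are matched by position in the enumerations; past the end, the default [b0] still lies
   in [T]. *)
exists (fun a => nth b0 (enum T) (index a (enum S))) => [a b aS bS|a].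
  have lt x : x \in S -> index x (enum S) < size (enum T).
    by move=> xS; rewrite -cardE (leq_trans _ ST) // cardE index_mem mem_enum.
  move/eqP; rewrite nth_uniq ?enum_uniq ?lt // => /eqP e.
  by rewrite -(nth_index a (_ : a \in enum S)) ?mem_enum // e nth_index ?mem_enum.
have [lt|ge] := ltnP (index a (enum S)) (size (enum T)).
  by rewrite -mem_enum mem_nth.
by rewrite nth_default.
Qed.

Section Matching.
Variables (t : nat) (M : {set {set complete t}}).
Hypothesis hM : maximal_matching M.

Let matchM : matching M. Proof. by case/maxsetP: hM. Qed.
Let trivM : trivIset M. Proof. by case/andP: matchM. Qed.

Lemma card_matching_edge e : e \in M -> #|e| = 2.
Proof.
case/andP: matchM => /subsetP sub _ /sub /imsetP[[x y]].
by rewrite inE /= => xy ->; rewrite cards2 (xy : x != y).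
Qed.

(** [H] is complete multipartite, and the blocks are its parts. *)
Definition block (u : complete t) : {set complete t} :=
  if u \in cover M then pblock M u else [set u].

Lemma mem_block u : u \in block u.
Proof. by rewrite /block; case: ifP; rewrite ?mem_pblock // inE. Qed.

Lemma block_eq u w : w \in block u -> block w = block u.
Proof.
rewrite /block; case: ifP => uM; last by rewrite inE => /eqP ->; rewrite uM.
move=> wu; have wM : w \in cover M.
  by apply/bigcupP; exists (pblock M u) => //; apply: pblock_mem.
by rewrite wM; apply/(def_pblock trivM) => //; apply: pblock_mem.
Qed.

Lemma card_block u : #|block u| <= 2.
Proof.
rewrite /block; case: ifP => uM; last by rewrite cards1.
by rewrite card_matching_edge // pblock_mem.
Qed.

Lemma block_edge u w : u != w -> block u = block w -> block u = [set u; w].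
Proof.
move=> uw e; apply/esym/eqP; rewrite eqEcard cards2 uw card_block andbT.
by apply/subsetP => x; rewrite !inE => /orP[]/eqP ->; rewrite ?mem_block // e mem_block.
Qed.

Lemma block_matching u w : u != w -> block u = block w -> [set u; w] \in M.
Proof.
move=> uw e; rewrite -(block_edge u w uw e) /block; case: ifP => [uM|uM].
  exact: pblock_mem.
have: w \in block u by rewrite e mem_block.
by rewrite /block uM inE eq_sym (negPf uw).
Qed.

(** An edge between two uncovered vertices could be added to [M], against maximality. *)
Lemma card_unmatched : #|~: cover M| <= 1.
Proof.
rewrite leqNgt; apply/negP => /card_gt1P[u [w [uM wM uw]]].
case/maxsetP: hM => _ /(_ ([set u; w] |: M)) maxM.
have : [set u; w] \in M.
  rewrite -maxM ?setU11 ?subsetU1 //; apply/andP; split.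
    rewrite subUset (andP matchM).1 andbT sub1set.
    by apply/imsetP; exists (u, w); rewrite ?inE.
  have [] // := @trivIsetU1 _ [set u; w] M _ trivM; last first.
    by apply/negP => /card_matching_edge; rewrite cards0.
  move=> B BM; rewrite disjoint_subset; apply/subsetP => x xuw.
  rewrite inE; apply/negP => xB.
  have : x \in cover M by apply/bigcupP; exists B.
  by move: uM wM xuw; rewrite !inE => ? ? /orP[]/eqP ->; apply/negP.
move=> uwM; move: uM; rewrite inE => /negP; apply.
by apply/bigcupP; exists [set u; w] => //; rewrite set21.
Qed.

(** A block is an edge of [M] or an uncovered vertex; there are [t - 2 * #|M|] of the latter, at
    most one. *)
Lemma card_blocks : #|[set block u | u : complete t]| <= uphalf t.
Proof.
have sub : [set block u | u : complete t] \subset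
    M :|: [set [set u] | u in ~: cover M].
  apply/subsetP => _ /imsetP[u _ ->]; rewrite inE /block; case: ifP => uM.
    by rewrite pblock_mem.
  by apply/orP; right; apply/imsetP; exists u; rewrite ?inE ?uM.
apply: leq_trans (subset_leq_card sub) _; rewrite cardsU.
apply: leq_trans (leq_subr _ _) _; rewrite card_imset; last exact: set1_inj.
have cov : #|cover M| = #|M|.*2.
  move: (trivM); rewrite /trivIset => /eqP <-.
  by rewrite (eq_bigr (fun=> 2)) ?sum_nat_const ?muln2 //; apply: card_matching_edge.
have := cardsC (cover M); rewrite cov [RHS]card_ord.
move/(congr1 uphalf) <-; case: #|~: _| card_unmatched => [|[|]] // _.
  by rewrite !addn0 uphalf_double.
by rewrite !addn1 /= doubleK.
Qed.

(** Each block gets a private colour other than [i0], and its vertices go to the ends of an edge of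
    that colour. No vertex sees two colours besides [i0], so edges chosen for different blocks are
    disjoint and joined only by [i0]. *)
Lemma embed_dominant (V C : finType) (col : V -> V -> C) i0 :
  (forall x y, col x y = col y x) ->
  (forall v x y, x <> v -> y <> v ->
    col v x <> i0 -> col v y <> i0 -> col v x = col v y) ->
  (forall i, exists x y, x <> y /\ col x y = i) ->
  uphalf t < #|C| -> 1 < #|C| ->
  exists2 f : complete t -> V, injective f &
    forall x y, @adj (delete_edges M) x y -> col (f x) (f y) = i0.
Proof.
move=> colC dom onto tC C1.
have cardi0 : #|[set~ i0]| = #|C|.-1 by rewrite cardsC1.
have [h hinj hi0] : exists2 h : {set complete t} -> C,
    {in [set block u | u : complete t] &, injective h} &
    forall a, h a \in [set~ i0].
  apply: injection_in; rewrite cardi0; last by rewrite -ltnS prednK // ltnW.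
  by apply: leq_trans card_blocks _; rewrite -ltnS prednK // ltnW.
have /fin_all_exists[p pP] : forall i : C, exists q : V * V,
    q.1 <> q.2 /\ col q.1 q.2 = i.
  by move=> i; have [x [y ?]] := onto i; exists (x, y).
pose phi u := h (block u).
have phi0 u : phi u <> i0 by move: (hi0 (block u)); rewrite !inE => /eqP.
have phi_inj u w : phi u = phi w -> block u = block w.
  by apply: hinj; apply: imset_f.
(* The least vertex of a block takes the first end of the chosen edge, the other one the second;
   [g u] is the end opposite to [f u]. *)
pose fst u := [forall w in block u, u <= w].
pose f u := if fst u then (p (phi u)).1 else (p (phi u)).2.
pose g u := if fst u then (p (phi u)).2 else (p (phi u)).1.
have fg u : f u <> g u /\ col (f u) (g u) = phi u.
  have [ne e] := pP (phi u); rewrite /f /g; case: ifP => _ //.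
  by rewrite colC; split=> //; apply: nesym.
have f_inj : injective f.
  move=> u w e; have bl : block u = block w.
    apply: phi_inj; have [nu eu] := fg u; have [nw ew] := fg w.
    by rewrite -eu -ew e; apply: dom; rewrite -?e ?eu ?e ?ew //; congruence.
  have [fe|fn] := fst u =P fst w; last first.
    have [ne _] := pP (phi u).
    by move: fn e; rewrite /f /phi -bl; case: (fst u) (fst w) => [] [] // _ /esym.
  apply/eqP; apply: contraT => uw.
  have be := block_edge u w uw bl.
  have fu : fst u = (u <= w).
    apply/forall_inP/idP => [-> //|uw' x]; rewrite be ?set22 //.
    by rewrite !inE => /orP[]/eqP ->.
  have fw : fst w = (w <= u).
    apply/forall_inP/idP => [-> //|uw' x]; rewrite -bl be ?set21 //.
    by rewrite !inE => /orP[]/eqP ->.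
  move: fe; rewrite fu fw; move: uw; rewrite -val_eqE /= neq_ltn.
  by case: ltngtP.
exists f => // u w /andP[uw uwM].
have bl : block u <> block w by move=> e; rewrite (block_matching u w uw e) in uwM.
have fuw : f u <> f w by move/f_inj/eqP; apply/negP.
apply/eqP; apply: contraT => /eqP ne; case: bl; apply: phi_inj.
have [nu eu] := fg u; have [nw ew] := fg w; have phi0u := phi0 u; have phi0w := phi0 w.
(* A colour other than [i0] on this edge would equal the private colours at both of its ends. *)
transitivity (col (f u) (f w)).
  by rewrite -eu; apply: dom; congruence.
by rewrite -ew colC; apply: dom; rewrite 1?colC; congruence.
Qed.
End Matching.

(** * Copies of graphs and the upper bound *)

Lemma image_edgesP (G F : sgraph) (f : G -> F) e :
  reflect (exists x y, adj x y /\ e = [set f x; f y]) (e \in image_edges f).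
Proof.
apply: (iffP imsetP) => [[_ /imsetP[[x y] xy ->] ->]|[x [y [xy ->]]]].
  by exists x, y; rewrite inE in xy; rewrite imsetU1 imset_set1.
exists [set x; y]; last by rewrite imsetU1 imset_set1.
by apply/imsetP; exists (x, y); rewrite ?inE.
Qed.

Lemma complete_edge n (x y : complete n) : x != y -> [set x; y] \in edges (complete n).
Proof. by move=> xy; apply/imsetP; exists (x, y); rewrite ?inE. Qed.

Lemma copy_in_complete (G : sgraph) n (f : G -> complete n) :
  injective f -> is_copy f.
Proof.
move=> finj; split=> //; apply/subsetP => e /image_edgesP[x [y [xy ->]]].
apply: complete_edge; rewrite (inj_eq finj).
by apply: contraTneq xy => ->; rewrite adj_irrefl.
Qed.

Lemma rainbow_P5_copy n k (col : {set complete n} -> 'I_k) a b c d e :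
  uniq [:: a; b; c; d; e] ->
  uniq [:: col [set a; b]; col [set b; c]; col [set c; d]; col [set d; e]] ->
  exists2 f : path_graph 5 -> complete n, is_copy f & rainbow col (image_edges f).
Proof.
move=> us uc; pose f : path_graph 5 -> complete n := tnth [tuple a; b; c; d; e].
exists f; first by apply: copy_in_complete; apply/tuple_uniqP.
pose es := [:: [set a; b]; [set b; c]; [set c; d]; [set d; e]].
have ess X : X \in image_edges f -> X \in es.
  case/image_edgesP => x [y [+ ->]]; rewrite /f !(tnth_nth a) /= /path_adj.
  move: x y => [[|[|[|[|[|x]]]]] ?] [[|[|[|[|[|y]]]]] ?] //= _;
    by rewrite !inE ?eqxx ?orbT // setUC eqxx ?orbT.
move=> X Y /ess + /ess; rewrite !inE.
by move=> /or4P[]/eqP -> /or4P[]/eqP -> // E; move: uc;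
  rewrite /= !inE E eqxx ?orbT ?andbF.
Qed.

Lemma complete_rainbow_or_mono k t n (M : {set {set complete t}})
    (c : {set complete n} -> 'I_k) :
  maximal_matching M -> 4 < k -> t < n -> 4 < n -> uphalf t < k -> exact_coloring c ->
  (exists2 f : path_graph 5 -> complete n, is_copy f & rainbow c (image_edges f)) \/
  (exists2 f : delete_edges M -> complete n, is_copy f & monochromatic c (image_edges f)).
Proof.
move=> hM k4 tn n4 tk exact.
have [|norb] := pselect (exists2 f : path_graph 5 -> complete n,
  is_copy f & rainbow c (image_edges f)); [by left | right].
pose col (x y : 'I_n) := c [set x; y].
have colC x y : col x y = col y x by rewrite /col setUC.
have noP5 : forall a b d e f,
  a <> b -> a <> d -> a <> e -> a <> f -> b <> d -> b <> e -> b <> f ->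
  d <> e -> d <> f -> e <> f ->
  col a b <> col b d -> col a b <> col d e -> col a b <> col e f ->
  col b d <> col d e -> col b d <> col e f -> col d e <> col e f -> False.
  move=> a b d e f *; apply: norb; apply: (rainbow_P5_copy n k c a b d e f);
  by rewrite /= !inE !negb_or; do ![apply/andP; split] => //; apply/eqP.
have onto i : exists x y, x <> y /\ col x y = i.
  have [X /imsetP[[x y]]] := exact i; rewrite inE /= => xy -> ci.
  by exists x, y; split=> //; apply/eqP.
have cardV : #|'I_n| = n := card_ord n; have cardC : #|'I_k| = k := card_ord k.
suff [f [i [finj fi]]] : exists (f : delete_edges M -> 'I_n) i,
    injective f /\ forall x y, @adj (delete_edges M) x y -> col (f x) (f y) = i.
  exists f; first exact: copy_in_complete.
  by exists i => _ /image_edgesP[x [y [xy ->]]]; apply: fi.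
have [/existsP[v v3]|/existsPn few] := boolP [exists v : 'I_n, 2 < #|seen _ _ col v|].
  have [||i vi] := many_seen_mono_off _ _ col colC noP5 v _ _ onto v3;
    rewrite ?cardV ?cardC //.
  have tn1 : t <= n.-1 by rewrite -ltnS prednK // (leq_ltn_trans _ tn).
  (* [lift v] skips [v], and the other [n.-1 >= t] vertices contain a whole [K_t] of one colour. *)
  exists (fun u : 'I_t => lift v (widen_ord tn1 u)), i; split=> [u w|u w /andP[uw _]].
    by move/lift_inj/(congr1 val)/(@val_inj _ _ 'I_t).
  apply: vi; last 2 first.
  - by apply/eqP; rewrite eq_sym neq_lift.
  - by apply/eqP; rewrite eq_sym neq_lift.
  by move/lift_inj/(congr1 val)/(@val_inj _ _ 'I_t)/eqP; apply/negP.
have [|||i0 dom] := few_seen_dominant _ _ col colC _ _ onto;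
  rewrite ?cardV ?cardC //.
- by apply: leq_trans n4.
- by apply: ltnW.
- by move=> v; rewrite leqNgt; apply: few.
have [||f finj fi] := embed_dominant t M hM _ _ col i0 colC dom onto;
  rewrite ?cardC //; first by apply: leq_trans k4.
by exists f, i0.
Qed.

(** * The lower bound *)

(* The extremal colouring: the edges [{0, i}] with [0 < i <= k] get the
   colours [i], all other edges the colour [0]. *)
Definition star_coloring n k (e : {set complete n.+1}) : 'I_k.+1 :=
  if ord0 \in e then inord (\max_(x in e) (if x < k.+1 then x : nat else 0)) else ord0.

(** [ord0] contributes 0, so the maximum over the edge reads off its other end. *)
Lemma star_coloringE n k (x : complete n.+1) : x < k.+1 ->
  star_coloring n k [set ord0; x] = inord x.
Proof.
move=> xk; rewrite /star_coloring set21; congr inord.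
have [->|x0] := eqVneq x ord0; first by rewrite setUid big_set1.
by rewrite big_setU1 ?inE 1?eq_sym //= big_set1 xk max0n.
Qed.

Lemma star_coloring_off n k (e : {set complete n.+1}) :
  ord0 \notin e -> star_coloring n k e = ord0.
Proof. by rewrite /star_coloring => /negPf ->. Qed.

Lemma star_coloring_exact n k : k < n -> 1 < n -> exact_coloring (star_coloring n k).
Proof.
move=> kn n1 i; have [->|i0] := eqVneq i ord0.
  exists [set inord 1; inord 2]; last first.
    rewrite star_coloring_off // !inE negb_or -!val_eqE /= !inordK //.
    exact: ltnW.
  apply: complete_edge; rewrite -val_eqE /= !inordK //; exact: ltnW.
have iltn : i < n.+1 by apply: leq_trans (ltn_ord i) _; apply: leqW.
exists [set ord0; inord i : complete n.+1].
  by apply: complete_edge; rewrite -val_eqE /= inordK // eq_sym.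
by rewrite star_coloringE inordK // inord_val.
Qed.

(** All edges off [ord0] share a colour, so a rainbow path has at most one of them; but a vertex
    meets at most two of the four edges of [P_5]. *)
Lemma star_coloring_no_rainbow n k (f : path_graph 5 -> complete n.+1) :
  injective f -> ~ rainbow (star_coloring n k) (image_edges f).
Proof.
move=> finj rb; pose o i : path_graph 5 := inord i.
have fE i j : i < 5 -> j < 5 -> (f (o i) == f (o j)) = (i == j).
  by move=> i5 j5; rewrite (inj_eq finj) -val_eqE /= !inordK.
have disj i j : i.+1 < 5 -> j.+1 < 5 -> i != j ->
    [|| f (o i) == ord0, f (o i.+1) == ord0, f (o j) == ord0 | f (o j.+1) == ord0].
  move=> i5 j5 ij; apply: contraT; rewrite !negb_or.
  move=> /and4P[i0 i0' j0 j0'].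
  have e : [set f (o i); f (o i.+1)] = [set f (o j); f (o j.+1)].
    have h m : m.+1 < 5 -> [set f (o m); f (o m.+1)] \in image_edges f.
      move=> m5; apply/image_edgesP; exists (o m), (o m.+1); split=> //.
      by rewrite /= /path_adj !inordK ?eqxx // ltnW.
    by apply: rb; rewrite ?h // !star_coloring_off // !inE negb_or !(eq_sym ord0) ?i0 ?j0.
  have : f (o i) \in [set f (o j); f (o j.+1)] by rewrite -e set21.
  have : f (o i.+1) \in [set f (o j); f (o j.+1)] by rewrite -e set22.
  have i5' := ltnW i5; have j5' := ltnW j5.
  rewrite !inE !fE // eqSS (negPf ij) orbF => /= /eqP <-.
  by rewrite eqn_leq (leqNgt i.+2) ltnS leqnSn andbF.
(* The pairs [(0, 1)] and [(2, 3)] of edges put [ord0] in the middle of the path, which the pair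
   [(0, 3)] excludes. *)
have := disj 0 1 isT isT isT; have := disj 2 3 isT isT isT; have := disj 0 3 isT isT isT.
have ne i j : i < 5 -> j < 5 -> i != j -> f (o i) == ord0 -> f (o j) == ord0 = false.
  by move=> i5 j5 ij /eqP <-; rewrite fE // eq_sym (negPf ij).
move=> /or4P[] h; rewrite ?h ?(ne _ _ _ _ _ h) //=.
Qed.

Lemma matched_unique t (M : {set {set complete t}}) u w z : trivIset M ->
  u != w -> w != z -> [set u; w] \in M -> [set u; z] \notin M.
Proof.
move=> /trivIsetP trivM uw wz wM; apply/negP => zM.
have [e|ne] := eqVneq [set u; w] [set u; z].
  have : w \in [set u; z] by rewrite -e set22.
  by rewrite !inE eq_sym (negPf uw) (negPf wz).
have := trivM _ _ wM zM ne; rewrite disjoint_subset => /subsetP /(_ u).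
by rewrite !inE eqxx => /(_ isT).
Qed.

(** The copy spans all vertices, and each vertex loses at most one edge to [M]. So vertex 1 keeps an
    edge to 2 or 3, of colour 0, while vertex 0 keeps an edge to 1 or 2, of nonzero colour. *)
Lemma star_coloring_no_mono n k (M : {set {set complete n.+1}})
    (f : delete_edges M -> complete n.+1) :
  trivIset M -> 1 < k -> 2 < n -> injective f ->
  ~ monochromatic (star_coloring n k) (image_edges f).
Proof.
move=> trivM k1 n2 finj [i mono].
have [g gK fK] : bijective f := injF_bij finj.
pose w j : complete n.+1 := g (inord j).
have fw j : f (w j) = inord j by apply: fK.
have wE j l : j < 4 -> l < 4 -> (w j == w l) = (j == l).
  move=> j4 l4; rewrite (inj_eq (can_inj fK)) -val_eqE /=.
  by rewrite !inordK //; [apply: leq_trans l4 _ | apply: leq_trans j4 _].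
have keep u a b : u < 4 -> a < 4 -> b < 4 -> u != a -> u != b -> a != b ->
    exists2 c, c \in [:: a; b] & star_coloring n k [set inord u; inord c] = i.
  move=> u4 a4 b4 ua ub ab.
  have edge c : c < 4 -> u != c -> [set w u; w c] \notin M ->
      star_coloring n k [set inord u; inord c] = i.
    move=> c4 uc cM; rewrite -!fw; apply: mono; apply/image_edgesP.
    by exists (w u), (w c); split=> //; apply/andP; split=> //=; rewrite /complete_adj wE.
  have [aM|aM] := boolP ([set w u; w a] \in M).
    exists b; rewrite ?inE ?eqxx ?orbT //; apply: edge => //.
    by apply: matched_unique trivM _ _ aM; rewrite wE.
  by exists a; rewrite ?inE ?eqxx //; apply: edge.
have inord0 : inord 0 = ord0 :> 'I_n.+1 by apply: val_inj; rewrite /= inordK.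
have i0 : i = ord0.
  have [c c23 <-] := keep 1 2 3 isT isT isT isT isT isT.
  rewrite star_coloring_off // !inE negb_or -!val_eqE /=.
  by move: c23; rewrite !inE => /orP[]/eqP ->; rewrite !inordK // ltnW // ltnW.
have [c c12] := keep 0 1 2 isT isT isT isT isT isT.
have ck : c < k.+1 by move: c12; rewrite !inE => /orP[]/eqP -> //; apply: ltnW.
have cn : c < n.+1 by move: c12; rewrite !inE => /orP[]/eqP ->; rewrite ltnW // ltnW.
rewrite inord0 i0 star_coloringE inordK // => /(congr1 val) /=.
by rewrite inordK // => c0; rewrite c0 in c12.
Qed.

(** * Arithmetic of the bound and conclusion *)

Import Order.TTheory GRing.Theory Num.Theory.

Theorem theorem2p6 (R : realType) (k t : nat) (M : {set {set complete t}})
    (hkt : (uphalf (t + 2) <= k <= t - 1)%N) (hk : (5 <= k)%N)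
    (hM : maximal_matching M) (N : nat) :
  is_gallai_ramsey k (path_graph 5) (delete_edges M) N <->
  (N%:Z = Order.max (Num.ceil ((1 + Num.sqrt (1 + 8 * k%:R)) / 2 : R))
                    (t.+1)%:Z)%R.
Proof.
case/andP: hkt; rewrite addn2 /= => tk kt.
have t5 : 5 < t by move: kt; case: (t) => [|t']; rewrite ?subn1 //=; move/(leq_trans hk).
have -> : (Order.max (Num.ceil ((1 + Num.sqrt (1 + 8 * k%:R)) / 2 : R))
    (t.+1)%:Z = t.+1%:Z)%R.
  apply/max_r; rewrite ceil_le_int.
  have kt' : (k%:R <= t%:R :> R)%R.
    by rewrite ler_nat (leq_trans kt) // leq_subr.
  have t1 : (1 <= t%:R :> R)%R by rewrite ler1n (leq_trans _ t5).
  rewrite ler_pdivrMr ?ltr0n //.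
  (* After squaring this reads [8k <= 4t(t + 1)], which follows from [k <= t] and [1 <= t]. *)
  have : (Num.sqrt (1 + 8 * k%:R) <= 2 * t%:R + 1 :> R)%R.
    rewrite -[leRHS]ger0_norm; last by lra.
    rewrite -sqrtr_sqr ler_wsqrtr //; nra.
  rewrite -[X in (_ <= X * _)%R]/(t.+1%:R)%R -natr1; lra.
have gr_t1 : gr_bound k (path_graph 5) (delete_edges M) t.+1.
  split.
    rewrite bin2 /=; apply: leq_trans kt _.
    rewrite geq_half_double -mul2n; apply: leq_mul; rewrite ?leq_subr //.
    by rewrite ltnS (leq_trans _ t5).
  move=> n tn c; apply: complete_rainbow_or_mono => //.
  by rewrite (leq_trans _ tn) // ltnS ltnW // ltnW.
(* A bound [N' <= t] would apply to [K_t] itself, which the star colouring refutes. *)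
have gr_min N' : gr_bound k (path_graph 5) (delete_edges M) N' -> t < N'.
  case=> _ gr; rewrite ltnNge; apply/negP => /gr {gr}.
  case/maxsetP: hM => /andP[_ trivM] _.
  case: t k M hk kt t5 trivM {tk gr_t1} => [//|n] [//|k'] M' hk' kt t5 trivM.
  move: kt; rewrite subn1 /= => kt.
  case/(_ (star_coloring n k')).
  - by apply: star_coloring_exact => //; rewrite -ltnS (leq_trans _ t5).
  - by case=> f [finj _] /(star_coloring_no_rainbow _ _ _ finj).
  - case=> f [finj _]; apply: star_coloring_no_mono => //.
      by rewrite -ltnS (leq_trans _ hk').
    by rewrite -ltnS (leq_trans _ t5).
split=> [[grN minN]|[->]]; last by split.
by congr Posz; apply/eqP; rewrite eqn_leq minN // gr_min.
Qed.
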